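(* Let $d,k\ge1$ be integers and let $\Phi$ be a Gaussian mixture density with $k$ components in $\mathbb{R}^d$ with means $\mu_1,\dots,\mu_k$ and covariance matrices $\Sigma_1=\cdots=\Sigma_k=\Sigma$. Let \[ r=\dim\mathrm{aff}\{\mu_1,\dots,\mu_k\}. \] Then there is an invertible affine change of variables $T:\mathbb{R}^d\to\mathbb{R}^r\times\mathbb{R}^{d-r}$ (the right-hand side being an orthogonal decomposition of $\mathbb{R}^d$) such that the transformed (pushed-forward) density $\widetilde\Phi(u,v)=|\det DT^{-1}|\,\Phi(T^{-1}(u,v))$ factors in the form \[ \widetilde\Phi(u,v)=C\,e^{-\|v\|^2/2}\,G(u),\qquad (u,v)\in\mathbb{R}^r\times\mathbb{R}^{d-r}, \] where $C>0$ is constant and $G$ is an $r$-dimensional homoscedastic Gaussian mixture density with the same number $k$ of components. When $r=0$, $G$ is understood as the unit density on $\mathbb{R}^0$.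
   Context: A $k$-component Gaussian mixture density on $\mathbb{R}^d$ is a function $\Phi(x)=\sum_{i=1}^k\alpha_i\phi_i(x)$, where $\alpha_i>0$, $\sum_{i=1}^k\alpha_i=1$, and $\phi_i(x)=(2\pi)^{-d/2}\det(\Sigma_i)^{-1/2}\exp\left(-\frac12(x-\mu_i)^\top\Sigma_i^{-1}(x-\mu_i)\right)$ with $\mu_i\in\mathbb{R}^d$ and each $\Sigma_i$ a (symmetric) positive definite $d\times d$ matrix. It is homoscedastic if all the covariance matrices $\Sigma_i$ are equal. $\mathrm{aff}(A)$ denotes the affine hull of $A$ and $\dim$ its dimension. $DT^{-1}$ is the (constant) Jacobian matrix of $T^{-1}$. *)

(* Defs.v *)
From HB Require Import structures.
From mathcomp Require Import all_boot all_order all_algebra.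
From mathcomp Require Import all_classical all_reals all_analysis.

Set Implicit Arguments.
Unset Strict Implicit.
Unset Printing Implicit Defensive.

Import Order.TTheory GRing.Theory Num.Theory.
Import numFieldNormedType.Exports.

Local Open Scope classical_set_scope.
Local Open Scope ring_scope.

(* Points of R^n are row vectors, so a quadratic form x^T A x reads
   x *m A *m x^T and the library Jacobian 'J f p acts on the right. *)

Section AffineGeometry.
Variable R : realType.

Definition affine_hull (V : lmodType R) (A : set V) : set V :=
  [set x | exists (n : nat) (t : 'I_n -> R) (a : 'I_n -> V),
     [/\ forall i, A (a i), \sum_i t i = 1 & x = \sum_i t i *: a i]].

Definition translate (V : vectType R) (p : V) (D : {vspace V}) : set V :=
  [set p + v | v in [set v | v \in D]].

Definition is_direction (V : vectType R) (A : set V) (D : {vspace V}) : Prop :=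
  exists p : V, A = translate p D.

(* Meaningful when A is a (nonempty) affine subspace, in which case the
   direction is unique, see affine_dim_translate; otherwise the value is 0. *)
Definition affine_dim (V : vectType R) (A : set V) : nat :=
  \dim (xget 0%VS [set D | is_direction A D]).

Lemma direction_sub (V : vectType R) (A : set V) (D E : {vspace V}) :
  is_direction A D -> is_direction A E -> (D <= E)%VS.
Proof.
move=> [p ->] [q pDqE]; apply/subvP => v vD.
have in_qE w : w \in D -> p + w - q \in E.
  move=> wD; have : translate q E (p + w) by rewrite -pDqE; exists w.
  by move=> [z zE <-]; rewrite addrC addKr.
have := rpredB (in_qE v vD) (in_qE 0 (mem0v D)).
by rewrite addr0 opprB addrA subrK addrC addKr.
Qed.

Lemma affine_dim_translate (V : vectType R) (p : V) (D : {vspace V}) :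
  affine_dim (translate p D) = \dim D.
Proof.
rewrite /affine_dim; case: xgetP => [E _ dirE|/(_ D) []]; last by exists p.
have dirD : is_direction (translate p D) D by exists p.
by congr (\dim _); apply/eqP; rewrite eqEsubv !(direction_sub _ dirE, direction_sub dirE).
Qed.

Lemma affine_dim_le (d r : nat) (A : set 'rV[R]_d) :
  affine_dim A = r -> (r <= d)%N.
Proof. by move=> <-; rewrite (leq_trans (dimvS (subvf _))) ?dimvf // /dim /= mul1n. Qed.

Definition is_affine_map (V W : lmodType R) (f : V -> W) : Prop :=
  exists (g : {linear V -> W}) (c : W), forall x, f x = g x + c.

End AffineGeometry.

Section Coordinates.
Variable R : realType.

(* The orthogonal decomposition R^d = R^r x R^(d-r) into the first r and the
   last d - r coordinates. *)
Definition split_coord (d r : nat) (rd : (r <= d)%N) (x : 'rV[R]_d) :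
    'rV[R]_r * 'rV[R]_(d - r) :=
  let y := castmx (erefl 1%N, esym (subnKC rd)) x in (lsubmx y, rsubmx y).

Definition join_coord (d r : nat) (rd : (r <= d)%N)
    (w : 'rV[R]_r * 'rV[R]_(d - r)) : 'rV[R]_d :=
  castmx (erefl 1%N, subnKC rd) (row_mx w.1 w.2).

(* The library norm of 'rV[R]_n is the sup norm, hence this definition. *)
Definition euclidean_norm (n : nat) (v : 'rV[R]_n) : R :=
  Num.sqrt (\sum_i (v 0 i) ^+ 2).

(* Tinv is the inverse of the change of variables T; its Jacobian matrix is
   taken after identifying R^r x R^(d-r) with R^d. *)
Definition pushforward_density (d r : nat) (rd : (r <= d)%N)
    (Tinv : 'rV[R]_r * 'rV[R]_(d - r) -> 'rV[R]_d) (Phi : 'rV[R]_d -> R)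
    (w : 'rV[R]_r * 'rV[R]_(d - r)) : R :=
  `|\det ('J (Tinv \o split_coord rd) (join_coord rd w))| * Phi (Tinv w).

End Coordinates.

Section GaussianMixtures.
Variable R : realType.

Definition posdefmx (n : nat) (A : 'M[R]_n) : Prop :=
  A^T = A /\ forall x : 'rV[R]_n, x != 0 -> 0 < (x *m A *m x^T) 0 0.

Definition gaussian_density (n : nat) (mu : 'rV[R]_n) (Sigma : 'M[R]_n)
    (x : 'rV[R]_n) : R :=
  (2 * pi) `^ (- (n%:R / 2)) * (\det Sigma) `^ (- (1 / 2)) *
  expR (- (1 / 2) * ((x - mu) *m invmx Sigma *m (x - mu)^T) 0 0).

Definition is_gaussian_mixture (n k : nat) (alpha : 'I_k -> R)
    (mu : 'I_k -> 'rV[R]_n) (Sigma : 'I_k -> 'M[R]_n) (Phi : 'rV[R]_n -> R) :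
    Prop :=
  [/\ forall i, 0 < alpha i,
      \sum_i alpha i = 1,
      forall i, posdefmx (Sigma i) &
      forall x, Phi x = \sum_i alpha i * gaussian_density (mu i) (Sigma i) x].

Definition is_homoscedastic_mixture (n k : nat) (Phi : 'rV[R]_n -> R) : Prop :=
  exists (alpha : 'I_k -> R) (mu : 'I_k -> 'rV[R]_n) (Sigma : 'I_k -> 'M[R]_n),
    is_gaussian_mixture alpha mu Sigma Phi /\ forall i j, Sigma i = Sigma j.

End GaussianMixtures.

(* Main.v *)
Require Import Defs.
From HB Require Import structures.
From mathcomp Require Import all_boot all_order all_algebra.
From mathcomp Require Import all_classical all_reals all_analysis.
From mathcomp Require Import ring.

Set Implicit Arguments.
Unset Strict Implicit.
Unset Printing Implicit Defensive.

Import Order.TTheory GRing.Theory Num.Theory.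
Import numFieldNormedType.Exports.

Local Open Scope classical_set_scope.
Local Open Scope ring_scope.

(** Work with the inner product [x *m invmx Sigma *m y^T] on row vectors.  Every
    component is then a function of the distance to its mean.  All the means lie
    in an affine subspace [p + D] with [\dim D = r].  Choose an orthonormal basis
    for this inner product whose first [r] vectors, the rows of [E], span [D],
    and whose other vectors, the rows of [F], span the orthogonal complement of
    [D] ([adapted_orthonormal_basis]).  In the coordinates
    [x = p + u *m E + v *m F] the i-th mean is [(c i, 0)], so Pythagoras turns the
    exponent of the i-th component into [- (|u - c i|^2 + |v|^2) / 2].  The
    factor [exp (- |v|^2 / 2)] does not depend on [i] and comes out of the sum;
    what remains is a mixture of [k] Gaussians in dimension [r], with
    means [c i] and identity covariance ([gaussian_density_split]).

    Three ingredients carry this: the direction of the affine hull of a finite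
    family is spanned by the differences [a i - a i0] ([affine_hull_range]);
    positive definite matrices are congruent to the identity
    ([posdefmx_orthonormal], by Gram-Schmidt), which gives the basis and the
    positivity of [\det Sigma]; and the Jacobian of an affine map is its matrix
    ([jacobian_affine]), so that the constant factor is positive. *)

(** * The affine hull of a finite family *)

Section AffineHull.
Variable R : realType.

(** An affine combination [\sum_i t i *: a i] equals
    [a i0 + \sum_i t i *: (a i - a i0)].  Conversely, coefficients on the
    differences can be prescribed freely: the coefficient of [a i0] absorbs
    whatever is missing for a total weight of 1. *)
Lemma affine_hull_range (V : vectType R) (k : nat) (a : 'I_k -> V) (i0 : 'I_k) :
  affine_hull (range a) =
  translate (a i0) <<[tuple a i - a i0 | i < k]>>%VS.
Proof.
set X := [tuple a i - a i0 | i < k].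
have XE (i : 'I_k) : X`_i = a i - a i0 by rewrite -tnth_nth tnth_mktuple.
apply/seteqP; split=> x.
- move=> [n [t [b [hb t1 ->]]]].
  exists (\sum_i t i *: (b i - a i0)) => /=.
    apply: memv_suml => i _; apply: memvZ; case: (hb i) => j _ <-.
    by rewrite -XE memv_span// mem_nth// size_tuple.
  under eq_bigr do rewrite scalerBr.
  by rewrite sumrB -scaler_suml t1 scale1r addrC subrK.
- move=> [v vX <-]; rewrite [in a i0 + _](coord_span (vX : v \in <<X>>%VS)).
  pose c i := coord X i v.
  (* The correction at [i0] brings the total weight to 1. *)
  exists k, (fun i => c i + (1 - \sum_j c j) *+ (i == i0)), a.
  have sum_i0 (W : nmodType) (z : W) : \sum_(i < k) z *+ (i == i0) = z.
    by rewrite (bigD1 i0)//= eqxx mulr1n big1 ?addr0// => i /negbTE->.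
  split=> [i||]; first by exists i.
    by rewrite big_split/= sum_i0 addrC subrK.
  under [RHS]eq_bigr do rewrite scalerDl.
  rewrite big_split/= [X in _ = _ + X](_ : _ = (1 - \sum_j c j) *: a i0); last first.
    rewrite -[RHS]sum_i0; apply: eq_bigr => i _.
    by case: eqP => [->|_]; rewrite ?mulr1n// !mulr0n scale0r.
  under eq_bigr do rewrite XE scalerBr.
  rewrite sumrB -scaler_suml scalerBl scale1r.
  by rewrite addrC addrAC -!addrA.
Qed.

(** Turns the dimension of the affine hull into a matrix: the rows of [U] are a
    basis of the direction, and [m] holds the coordinates of [mu i - mu i0]. *)
Lemma affine_hull_coordinates (d k r : nat) (mu : 'I_k -> 'rV[R]_d)
    (i0 : 'I_k) :
  affine_dim (affine_hull (range mu)) = r ->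
  exists2 U : 'M[R]_(r, d), row_free U &
    forall i, exists m : 'rV[R]_r, mu i = m *m U + mu i0.
Proof.
rewrite (affine_hull_range mu i0) affine_dim_translate.
set D := (<<_>>)%VS => <-.
pose U := \matrix_(j < \dim D) (vbasis D)`_j.
have mulU (w : 'rV_(\dim D)) : w *m U = \sum_j w 0 j *: (vbasis D)`_j.
  by rewrite mulmx_sum_row; apply: eq_bigr => j _; rewrite rowK.
exists U.
  rewrite -kermx_eq0; apply/rowV0P => w /sub_kermxP; rewrite mulU => w0.
  apply/rowP => j; rewrite mxE.
  exact: (freeP (basis_free (vbasisP D)) _ w0).
move=> i; exists (\row_j coord (vbasis D) j (mu i - mu i0)).
have /coord_vbasis : mu i - mu i0 \in D.
  by apply: memv_span; apply/tnthP; exists i; rewrite tnth_mktuple.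
move/(canRL (subrK _)) => {1}->; congr (_ + _).
by rewrite mulU; apply: eq_bigr => j _; rewrite mxE.
Qed.

End AffineHull.

(** * Orthonormal bases for a positive definite form *)

Section PositiveDefinite.
Variable R : realType.

Lemma mul_trE (n : nat) (x : 'rV[R]_n) : (x *m x^T) 0 0 = \sum_i x 0 i ^+ 2.
Proof. by rewrite mxE; apply: eq_bigr => i _; rewrite mxE expr2. Qed.

Lemma posdefmx1 (n : nat) : posdefmx (1%:M : 'M[R]_n).
Proof.
split=> [|x x0]; first by rewrite trmx1.
rewrite mulmx1 mul_trE lt_neqAle sumr_ge0 ?andbT; last by move=> i _; exact: sqr_ge0.
apply: contra x0; rewrite eq_sym psumr_eq0; last by move=> i _; exact: sqr_ge0.
move=> /allP x0; apply/eqP/rowP => i; rewrite mxE.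
by apply/eqP; rewrite -sqrf_eq0; apply: x0; rewrite mem_index_enum.
Qed.

Lemma posdefmx_congr (m n : nat) (S : 'M[R]_n) (U : 'M[R]_(m, n)) :
  posdefmx S -> row_free U -> posdefmx (U *m S *m U^T).
Proof.
move=> [Ssym Spos] Ufree; split=> [|x x0].
  by rewrite !trmx_mul trmxK Ssym mulmxA.
have := Spos (x *m U); rewrite trmx_mul !mulmxA; apply.
by rewrite mulmx_free_eq0.
Qed.

Lemma orthonormal_col_mx (d r m : nat) (A : 'M[R]_d) (E : 'M[R]_(r, d))
    (F : 'M[R]_(m, d)) :
  A^T = A -> E *m A *m E^T = 1%:M -> F *m A *m F^T = 1%:M ->
  F *m A *m E^T = 0 ->
  col_mx E F *m A *m (col_mx E F)^T = 1%:M.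
Proof.
move=> Asym EE FF FE; rewrite mul_col_mx tr_col_mx mul_col_row EE FF FE.
have -> : E *m A *m F^T = 0.
  by apply: trmx_inj; rewrite trmx0 -FE !trmx_mul trmxK Asym mulmxA.
by rewrite -scalar_mx_block.
Qed.

(** The orthogonal of the rows of [E] is the kernel of [A *m E^T], which has
    [E] as a left inverse and hence rank [r].  The number of rows [m] is a
    parameter, tied to [d] and [r] by an equation only, so that no cast is
    needed at the places of use. *)
Lemma orthogonal_complement (d r m : nat) (A : 'M[R]_d) (E : 'M[R]_(r, d)) :
  (r + m)%N = d -> E *m A *m E^T = 1%:M ->
  exists2 V : 'M[R]_(m, d), row_free V & V *m A *m E^T = 0.
Proof.
move=> rmd EE; pose K := kermx (A *m E^T).
have rkAE : \rank (A *m E^T) = r.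
  apply/eqP; rewrite -[_ == _]/(row_full _); apply/row_fullP.
  by exists E; rewrite mulmxA.
have rkK : \rank K = m by rewrite mxrank_ker rkAE -rmd addKn.
case: m / rkK rmd => _; exists (row_base K); first exact: row_base_free.
by rewrite -mulmxA; apply/sub_kermxP; rewrite eq_row_base.
Qed.

(** Gram-Schmidt by induction on the dimension: normalize the first basis
    vector, restrict the form to the orthogonal complement of that vector, and
    apply the induction hypothesis to the restriction. *)
Lemma posdefmx_orthonormal (n : nat) (S : 'M[R]_n) :
  posdefmx S -> exists B : 'M[R]_n, B *m S *m B^T = 1%:M.
Proof.
elim: n S => [|n IH] S Spd; first by exists 1%:M; apply/matrixP => -[].
pose e : 'rV[R]_n.+1 := delta_mx 0 0.
have e0 : e != 0.
  by apply/eqP => /rowP/(_ 0)/eqP; rewrite !mxE !eqxx oner_eq0.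
have := Spd.2 e e0; set a := (X in 0 < X) => a0.
pose E := (Num.sqrt a)^-1 *: e.
have EE : E *m S *m E^T = 1%:M.
  rewrite /E linearZ/= -!scalemxAl -scalemxAr scalerA.
  rewrite [e *m S *m _]mx11_scalar -/a scale_scalar_mx.
  by rewrite -invfM -expr2 sqr_sqrtr ?ltW// mulVf ?gt_eqF.
have [V Vfree VE] := orthogonal_complement (erefl : (1 + n)%N = n.+1) EE.
have [B BB] := IH _ (posdefmx_congr Spd Vfree).
exists (col_mx E (B *m V)); apply: (orthonormal_col_mx Spd.1 EE).
  by rewrite trmx_mul -BB !mulmxA.
by rewrite -!mulmxA (mulmxA V) VE mulmx0.
Qed.

Lemma posdefmx_det_gt0 (n : nat) (S : 'M[R]_n) : posdefmx S -> 0 < \det S.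
Proof.
move=> /posdefmx_orthonormal[B /(congr1 determinant)].
rewrite !det_mulmx det_tr det1 mulrAC -expr2 => BS.
have B2 : 0 < \det B ^+ 2.
  rewrite exprn_even_gt0//=; apply/eqP => B0; move/eqP: BS.
  by rewrite B0 expr0n/= mul0r eq_sym oner_eq0.
by rewrite -(pmulr_rgt0 _ B2) BS.
Qed.

(** [invmx S] is the congruent of [S] by [invmx S] itself. *)
Lemma posdefmx_inv (n : nat) (S : 'M[R]_n) : posdefmx S -> posdefmx (invmx S).
Proof.
move=> Spd; have Su : S \in unitmx.
  by rewrite unitmxE unitfE gt_eqF ?posdefmx_det_gt0.
have -> : invmx S = invmx S *m S *m (invmx S)^T.
  by rewrite mulVmx// mul1mx trmx_inv Spd.1.
by apply: posdefmx_congr; rewrite // row_free_unit unitmx_inv.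
Qed.

(** Orthonormalize the form on the row space of [U] and on its orthogonal
    complement separately. *)
Lemma adapted_orthonormal_basis (d r m : nat) (A : 'M[R]_d)
    (U : 'M[R]_(r, d)) :
  (r + m)%N = d -> posdefmx A -> row_free U ->
  exists (E : 'M[R]_(r, d)) (F : 'M[R]_(m, d)),
    (U <= E)%MS /\ col_mx E F *m A *m (col_mx E F)^T = 1%:M.
Proof.
move=> rmd Apd Ufree.
have [B BB] := posdefmx_orthonormal (posdefmx_congr Apd Ufree).
have EE : (B *m U) *m A *m (B *m U)^T = 1%:M by rewrite trmx_mul -BB !mulmxA.
have [V Vfree VE] := orthogonal_complement rmd EE.
have [C CC] := posdefmx_orthonormal (posdefmx_congr Apd Vfree).
exists (B *m U), (C *m V); split.
  have /mulmx1_unit[Bu _] : B *m (U *m A *m U^T *m B^T) = 1%:M.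
    by rewrite -BB !mulmxA.
  by rewrite -{1}(mulKmx Bu U) submxMl.
apply: (orthonormal_col_mx Apd.1 EE).
  by rewrite trmx_mul -CC !mulmxA.
by rewrite -!mulmxA (mulmxA V) VE mulmx0.
Qed.

End PositiveDefinite.

(** * Square matrices whose dimensions are only provably equal *)

(** The matrix of the new basis has [r + (d - r)] rows and [d] columns, so
    its one-sided inverse has to be seen as two-sided across the equation
    [r + (d - r) = d]. *)
Lemma mulmx1C_eq (K : comNzRingType) (m n : nat) (A : 'M[K]_(m, n))
    (B : 'M[K]_(n, m)) : m = n -> A *m B = 1%:M -> B *m A = 1%:M.
Proof. by move=> e; case: n / e A B => A B; exact: mulmx1C. Qed.

Lemma det_castmx_neq0 (K : fieldType) (m n : nat) (e : m = n)
    (A : 'M[K]_(m, n)) (B : 'M[K]_(n, m)) :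
  A *m B = 1%:M -> \det (castmx (e, erefl n) A) != 0.
Proof.
case: n / e A B => A B; rewrite castmx_id => /mulmx1_unit[].
by rewrite unitmxE unitfE.
Qed.

Lemma castmx_row_mul (K : pzSemiRingType) (m n p : nat) (e : m = n) (x : 'rV[K]_n)
    (A : 'M[K]_(m, p)) :
  castmx (erefl 1%N, esym e) x *m A = x *m castmx (e, erefl p) A.
Proof. by case: n / e x => x; rewrite !castmx_id. Qed.

(** * Jacobian of an affine map *)

Section Jacobian.
Variable R : realType.

(** [x *m P] is the combination of the rows of [P] with the entries of [x] as
    coefficients, and the entries are differentiable functions of [x]. *)
Lemma continuous_mulmxr (m n : nat) (P : 'M[R]_(m, n)) :
  continuous (mulmxr P : 'rV[R]_m -> 'rV[R]_n).
Proof.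
move=> x; apply: differentiable_continuous.
rewrite (_ : _ P = \sum_(i < m) fun y : 'rV[R]_m => y 0 i *: row i P).
  apply: differentiable_sum => i.
  by apply: differentiableZl; exact: differentiable_coord.
by apply/funext => y; rewrite /= mulmx_sum_row fct_sumE.
Qed.

Lemma jacobian_affine (m n : nat) (P : 'M[R]_(m, n)) (c : 'rV[R]_n)
    (p : 'rV[R]_m) : 'J (fun x => x *m P + c) p = P.
Proof.
have cP := @continuous_mulmxr m n P.
apply/row_matrixP => i; rewrite !rowE /jacobian mul_rV_lin1.
rewrite (_ : (fun x => _) = (mulmxr P : 'rV[R]_m -> 'rV[R]_n) + cst c)//.
rewrite diffD//; last exact: linear_differentiable.
(* Rewriting with either differential makes unification unfold the other one,
   so the two values are combined by congruence. *)
pose e : 'rV[R]_m := delta_mx 0 i.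
have dc := congr1 (fun g : _ -> _ => g e) (diff_cst c p).
have dP := congr1 (fun g : _ -> _ => g e) (diff_lin p cP).
exact: etrans (congr2 +%R dP dc) (addr0 _).
Qed.

End Jacobian.

(** * Factorization of the mixture *)

(** In an orthonormal basis of [invmx Sigma] the quadratic form is the sum of
    squares of the coordinates, and the mean [c *m E + p] has no component
    along [F].  The power of [2 * pi] is shared between the two factors according to
    their dimensions; [\det Sigma] goes to the constant, the component on [R^r]
    having covariance 1. *)
Lemma gaussian_density_split (R : realType) (d r m : nat) (Sigma : 'M[R]_d)
    (E : 'M[R]_(r, d)) (F : 'M[R]_(m, d)) (p : 'rV[R]_d) (c u : 'rV[R]_r)
    (v : 'rV[R]_m) :
  (r + m)%N = d ->
  col_mx E F *m invmx Sigma *m (col_mx E F)^T = 1%:M ->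
  gaussian_density (c *m E + p) Sigma (u *m E + v *m F + p) =
  (2 * pi) `^ (- (m%:R / 2)) * (\det Sigma) `^ (- (1 / 2)) *
  expR (- (euclidean_norm v ^+ 2 / 2)) * gaussian_density c 1%:M u.
Proof.
move=> rmd EF1; rewrite /gaussian_density.
have -> : u *m E + v *m F + p - (c *m E + p) =
    row_mx (u - c) v *m col_mx E F.
  by rewrite mul_row_col mulmxBl opprD addrACA subrr addr0 addrAC.
have -> (w : 'rV_(r + m)) :
    w *m col_mx E F *m invmx Sigma *m (w *m col_mx E F)^T = w *m w^T.
  by rewrite trmx_mul !mulmxA -2!(mulmxA w) EF1 mulmx1.
rewrite tr_row_mx mul_row_col mxE invmx1 mulmx1.
have -> : (v *m v^T) 0 0 = euclidean_norm v ^+ 2.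
  rewrite mul_trE /euclidean_norm sqr_sqrtr ?sumr_ge0// => i _; exact: sqr_ge0.
have : 0 < 2 * pi :> R by rewrite mulr_gt0 ?pi_gt0.
(* [pi] must not be unfolded by simplification. *)
move: (2 * pi) => t t0; rewrite det1 powR1 mulr1 mulrDr expRD.
rewrite -{1}rmd natrD mulrDl opprD powRD; last by rewrite (gt_eqF t0) implybT.
rewrite !mulNr !mul1r [2^-1 * euclidean_norm v ^+ 2]mulrC.
by ring.
Qed.

Lemma is_affine_map_mulmx (R : realType) (d r m : nat) (A : 'M[R]_(d, r))
    (B : 'M[R]_(d, m)) (p : 'rV[R]_d) :
  is_affine_map (fun x => ((x - p) *m A, (x - p) *m B)).
Proof.
pose g (x : 'rV[R]_d) := (x *m A, x *m B).
have glin : linear g by move=> a x y; rewrite /g !mulmxDl -!scalemxAl.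
pose gM := GRing.isLinear.Build R 'rV[R]_d ('rV[R]_r * 'rV[R]_m)%type _ g glin.
pose gL : {linear 'rV[R]_d -> ('rV[R]_r * 'rV[R]_m)%type} := HB.pack g gM.
by exists gL, (- g p) => x; rewrite /= /g !mulmxBl.
Qed.

Theorem theorem3p16 (R : realType) (d k : nat) (hd : (1 <= d)%N)
    (hk : (1 <= k)%N) (Phi : 'rV[R]_d -> R) (alpha : 'I_k -> R)
    (mu : 'I_k -> 'rV[R]_d) (Sigmas : 'I_k -> 'M[R]_d) (Sigma : 'M[R]_d)
    (hPhi : is_gaussian_mixture alpha mu Sigmas Phi)
    (hSigma : forall i, Sigmas i = Sigma)
    (r : nat) (hr : affine_dim (affine_hull (range mu)) = r) :
  exists (T : 'rV[R]_d -> 'rV[R]_r * 'rV[R]_(d - r))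
         (Tinv : 'rV[R]_r * 'rV[R]_(d - r) -> 'rV[R]_d),
    [/\ is_affine_map T, cancel T Tinv, cancel Tinv T &
        exists (C : R) (G : 'rV[R]_r -> R),
          [/\ 0 < C,
              is_homoscedastic_mixture k G,
              r = 0%N -> forall u, G u = 1 &
              forall (u : 'rV[R]_r) (v : 'rV[R]_(d - r)),
                pushforward_density (affine_dim_le hr) Tinv Phi (u, v) =
                C * expR (- (euclidean_norm v ^+ 2 / 2)) * G u]].
Proof.
have [alpha_gt0 alpha_sum Sigmas_pd PhiE] := hPhi.
pose i0 : 'I_k := Ordinal hk.
have Sigma_pd : posdefmx Sigma by rewrite -(hSigma i0).
set rd := affine_dim_le hr; have rmd := subnKC rd.
have [U Ufree muU] := affine_hull_coordinates i0 hr.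
have [E [F [UE EF1]]] :=
  adapted_orthonormal_basis rmd (posdefmx_inv Sigma_pd) Ufree.
pose p := mu i0; pose A := invmx Sigma; pose Q := col_mx E F.
have /boolp.choice[c muE] : forall i, exists c : 'rV[R]_r, mu i = c *m E + p.
  move=> i; have [m ->] := muU i; have /submxP[B ->] := UE.
  by exists (m *m B); rewrite mulmxA.
pose Tinv (w : 'rV[R]_r * 'rV[R]_(d - r)) := w.1 *m E + w.2 *m F + p.
pose T (x : 'rV[R]_d) := ((x - p) *m (A *m E^T), (x - p) *m (A *m F^T)).
have EFblock : block_mx (E *m A *m E^T) (E *m A *m F^T)
                        (F *m A *m E^T) (F *m A *m F^T) = block_mx 1%:M 0 0 1%:M.
  by rewrite -mul_col_row -mul_col_mx -tr_col_mx EF1 scalar_mx_block.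
have [EE EF FE FF] := eq_block_mx EFblock.
(* Orthonormality makes [A *m Q^T] a right inverse of [Q]; squareness makes it
   a left inverse, that is, the basis spans the whole space. *)
have QQ : A *m Q^T *m Q = 1%:M.
  by apply: mulmx1C_eq rmd _; rewrite mulmxA.
have TinvE : Tinv \o split_coord rd =
    fun x => x *m castmx (rmd, erefl d) Q + p.
  apply/funext => x; rewrite /Tinv /= -castmx_row_mul -mul_row_col hsubmxK.
  by congr (castmx (_, _) _ *m _ + _); exact: eq_irrelevance.
exists T, Tinv; split.
- exact: is_affine_map_mulmx.
- move=> x; rewrite /Tinv /T /= -!mulmxA -mulmxDr -!mulmxDr.
  have -> : E^T *m E + F^T *m F = Q^T *m Q by rewrite tr_col_mx mul_row_col.
  by rewrite (mulmxA A) QQ mulmx1 subrK.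
- move=> [u v]; rewrite /Tinv /T /= addrK !mulmxDl -!mulmxA !(mulmxA _ A).
  by rewrite EE EF FE FF !mulmx1 !mulmx0 addr0 add0r.
pose D := `|\det (castmx (rmd, erefl d) Q)|.
pose K := (2 * pi) `^ (- ((d - r)%:R / 2)) * (\det Sigma) `^ (- (1 / 2)) : R.
exists (D * K), (fun u => \sum_i alpha i * gaussian_density (c i) 1%:M u); split.
- rewrite !mulr_gt0 ?powR_gt0 ?mulr_gt0 ?pi_gt0 ?posdefmx_det_gt0//.
  by rewrite normr_gt0 (det_castmx_neq0 _ (B := A *m Q^T))// mulmxA.
- exists alpha, c, (fun=> 1%:M); split=> //; split=> // i.
  exact: posdefmx1.
(* For [r = 0] every component is the constant 1, and the weights sum to 1. *)
- move=> r0 u; rewrite -[RHS]alpha_sum; apply: eq_bigr => i _.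
  rewrite /gaussian_density det1 powR1 mulr1 invmx1 mulmx1 mul_trE.
  rewrite big1; last by case=> j jr; have : (j < 0)%N by rewrite -r0.
  by rewrite r0 mul0r oppr0 powRr0 mulr0 expR0 !mulr1.
move=> u v; rewrite /pushforward_density TinvE jacobian_affine -/D -!mulrA.
congr (_ * _); rewrite PhiE !mulr_sumr; apply: eq_bigr => i _.
rewrite hSigma muE gaussian_density_split// -/K.
by rewrite mulrCA !mulrA.
Qed.
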